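(* Let $S$, $\mathcal Z$, $h^{\mathcal Z}$, $R$ and $g_R=R^*h^{\mathcal Z}$ be as in the context, and let $S_{\mathrm{comp}}=\{p\in S:\ker R_p=\{0\}\}$. Then the restriction $g_R|_{S_{\mathrm{comp}}}$ is a smooth Riemannian metric. Equivalently, for every $p\in S$ the following are equivalent: (1) $p\in S_{\mathrm{comp}}$; (2) $R_p$ is injective; (3) $(g_R)_p$ is positive definite.
   Context: $S$ is a smooth finite-dimensional manifold parameterizing a smooth family $\{g_p\}_{p\in S}$ of normalized Einstein metrics on a fixed smooth manifold $M$ (smooth dependence: the metric coefficients are smooth in local coordinates on $S\times M$). The family comes with the following given data, which is all that the statement uses: a smooth real vector bundle $\pi_{\mathcal Z}:\mathcal Z\to S$ of finite rank (the observation bundle), a smooth positive-definite fibre metric $h^{\mathcal Z}$ on $\mathcal Z$, and a smooth vector bundle morphism $R:TS\to\mathcal Z$ over the identity of $S$ (the response bundle morphism), with fibre maps $R_p:T_pS\to\mathcal Z_p$. The response metric is the covariant 2-tensor $g_R=R^*h^{\mathcal Z}$, i.e. $(g_R)_p(X,Y)=h^{\mathcal Z}_p(R_pX,R_pY)$ for $X,Y\in T_pS$. The set $S_{\mathrm{comp}}$ (the complete-response locus) is an open subset of $S$. *)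

(* Defs.v *)
From HB Require Import structures.
From mathcomp Require Import all_boot all_order all_algebra.
From mathcomp Require Import all_classical all_reals all_analysis.
Set Implicit Arguments.
Unset Strict Implicit.
Unset Printing Implicit Defensive.
Import Order.TTheory GRing.Theory Num.Theory.
Import numFieldNormedType.Exports.
Local Open Scope classical_set_scope.
Local Open Scope ring_scope.

(* f is of class C^k on the open set U; C^(k+1) means Frechet differentiable
   with all directional derivatives of class C^k. *)
Fixpoint Ck_on (R : realType) (V W : normedModType R) (k : nat) (U : set V)
    (f : V -> W) : Prop :=
  if k is k'.+1 then
    (forall x, U x -> differentiable f x) /\ forall v, Ck_on k' U ('D_v f)
  else forall x, U x -> {for x, continuous f}.

Definition smooth_on (R : realType) (V W : normedModType R) (U : set V)
  (f : V -> W) : Prop := forall k, Ck_on k U f.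

(* chart_inv is a total function, but only its values on the image
   chart_map @` chart_dom matter. *)
Record chart (R : realType) (M : topologicalType) (n : nat) := Chart {
  chart_dom : set M;
  chart_map : M -> 'rV[R]_n;
  chart_inv : 'rV[R]_n -> M;
  chart_dom_open : open chart_dom;
  chart_img_open : open (chart_map @` chart_dom);
  chart_mapK : {in chart_dom, cancel chart_map chart_inv};
  chart_map_cont : forall p, chart_dom p -> {for p, continuous chart_map};
  chart_inv_cont : forall x, (chart_map @` chart_dom) x ->
    {for x, continuous chart_inv} }.

Definition smooth_compat (R : realType) (M : topologicalType) (n : nat)
    (c d : chart R M n) : Prop :=
  smooth_on (chart_map c @` (chart_dom c `&` chart_dom d))
            (chart_map d \o chart_inv c).

(* matlas is any smooth atlas; it need not be maximal. *)
Record manifold (R : realType) (n : nat) := Manifold {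
  mcarrier :> topologicalType;
  mhausdorff : hausdorff_space mcarrier;
  msecond_countable : @second_countable mcarrier;
  matlas : set (chart R mcarrier n);
  matlas_cover : forall p, exists2 c, matlas c & chart_dom c p;
  matlas_compat : forall c d, matlas c -> matlas d -> smooth_compat c d }.

Section Ck_theory.
Context {R : realType}.
Implicit Types V W : normedModType R.

Lemma near0_differentiable V W (f : V -> W) (x : V) :
  (\forall y \near x, f y = 0) -> differentiable f x.
Proof.
move=> f0; have fx0 : f x = 0 by exact: nbhs_singleton f0.
have E : f \o shift x = cst (f x) + (\0 : {linear V -> W}) +o_ 0 id.
  apply/eqaddoP => _/posnumP[e].
  have : \forall y \near (0 : V), f (shift x y) = 0.
    by have := f0; rewrite (near_shift 0) subr0.
  apply: filterS => y /= h.
  by rewrite !fctE /= h fx0 addr0 subr0 normr0 mulr_ge0.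
have c0 : continuous (\0 : {linear V -> W}) by move=> ?; exact: cvg_cst.
by apply/diff_locallyP; rewrite (diff_unique c0 E).
Qed.

Lemma near_differentiable V W (f g : V -> W) (x : V) :
  (\forall y \near x, f y = g y) -> differentiable f x -> differentiable g x.
Proof.
move=> fg df; have -> : g = f + (g - f) by rewrite addrC subrK.
apply: differentiableD => //; apply: near0_differentiable.
by apply: filterS fg => y /= fgy; rewrite !fctE fgy subrr.
Qed.

Lemma Ck_cont V W k (U : set V) (f : V -> W) x :
  Ck_on k U f -> U x -> {for x, continuous f}.
Proof.
case: k => [|k] /= ; first by move=> h; exact: h.
by move=> [h _] Ux; apply: differentiable_continuous; exact: h.
Qed.

Lemma Ck_sub V W k (A U : set V) (f : V -> W) :
  A `<=` U -> Ck_on k U f -> Ck_on k A f.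
Proof.
move=> AU; elim: k f => [|k IH] f /=; first by move=> h x /AU; exact: h.
by move=> [h1 h2]; split=> [x /AU|v]; [exact: h1 | apply: IH].
Qed.

Lemma Ck_weak V W k (U : set V) (f : V -> W) :
  Ck_on k.+1 U f -> Ck_on k U f.
Proof.
elim: k f => [|k IH] f; first by move=> h x Ux; apply: (Ck_cont h).
by move=> [h1 h2]; split=> // v; apply: IH; exact: h2.
Qed.

Lemma Ck_congr V W k (U : set V) (f g : V -> W) :
  open U -> (forall x, U x -> f x = g x) -> Ck_on k U f -> Ck_on k U g.
Proof.
move=> oU.
have near_ (a b : V -> W) x : (forall x, U x -> a x = b x) -> U x ->
    \forall y \near x, a y = b y.
  by move=> ab Ux; apply: filterS ab _; exact: open_nbhs_nbhs.
elim: k f g => [|k IH] f g fg.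
  move=> h x Ux; have nfg := near_ _ _ _ fg Ux.
  have := h x Ux; rewrite /prop_for /continuous_at -(fg _ Ux).
  by apply: cvg_trans; apply: near_eq_cvg; apply: filterS nfg => ? ->.
move=> [h1 h2]; split=> [x Ux|v].
  by apply: near_differentiable (near_ _ _ _ fg Ux) _; exact: h1.
by apply: IH (h2 v) => x Ux; apply: near_eq_derive; exact: near_.
Qed.

Lemma Ck_cst V W k (U : set V) (a : W) : Ck_on k U (cst a : V -> W).
Proof.
elim: k a => [|k IH] a /=; first by move=> x _; exact: cvg_cst.
split=> [x _|v]; first exact: differentiable_cst.
have -> : 'D_v (cst a : V -> W) = cst 0; last exact: IH.
by apply/funext => x; exact: derive_cst.
Qed.

Lemma Ck_lin V W (X : normedModType R) k (U : set V) (f : V -> W)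
    (L : {linear W -> X}) : open U -> continuous L ->
  Ck_on k U f -> Ck_on k U (L \o f).
Proof.
move=> oU cL; elim: k f => [|k IH] f.
  move=> h x Ux; apply: continuous_comp; first exact: h.
  exact: cL.
have dL y : differentiable L y by exact: linear_differentiable.
move=> [h1 h2]; split=> [x Ux|v].
  by apply: differentiable_comp => //; exact: h1.
apply: (Ck_congr oU _ (IH _ (h2 v))) => x Ux /=.
have df := h1 _ Ux; have dLf := differentiable_comp df (dL (f x)).
by rewrite (deriveE v df) (deriveE v dLf) (diff_comp df (dL _)) (diff_lin _ cL).
Qed.

Lemma Ck_add V W k (U : set V) (f g : V -> W) : open U ->
  Ck_on k U f -> Ck_on k U g -> Ck_on k U (f \+ g).
Proof.
move=> oU; elim: k f g => [|k IH] f g.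
  by move=> h1 h2 x Ux; exact: (continuousD (h1 x Ux) (h2 x Ux)).
move=> [f1 f2] [g1 g2]; split=> [x Ux|v].
  by apply: differentiableD; [exact: f1 | exact: g1].
apply: (Ck_congr oU _ (IH _ _ (f2 v) (g2 v))) => x Ux /=.
by rewrite -deriveD //; apply: diff_derivable; [exact: f1 | exact: g1].
Qed.

Lemma Ck_sum V W (I : Type) (s : seq I) k (U : set V) (f : I -> V -> W) :
  open U -> (forall i, Ck_on k U (f i)) ->
  Ck_on k U (fun x => \sum_(i <- s) f i x).
Proof.
move=> oU Cf; elim: s => [|i s IH].
  apply: (Ck_congr oU _ (Ck_cst k U 0)) => x _.
  by rewrite big_nil.
apply: (Ck_congr oU _ (Ck_add oU (Cf i) IH)) => x _.
by rewrite big_cons.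
Qed.

Lemma scale_differentiable V W (a : V -> R) (f : V -> W) x :
  differentiable a x -> differentiable f x ->
  is_diff x (fun y => a y *: f y) (fun v => a x *: 'd f x v + 'd a x v *: f x).
Proof.
move=> da df.
have sB : bilinear_for (GRing.Scale.Law.clone _ _ *:%R _)
    (GRing.Scale.Law.clone _ _ *:%R _) (@GRing.scale R W).
  split=> [u'|u] b y z /=; first by rewrite scalerDl scalerA.
  by rewrite scalerDr !scalerA mulrC.
pose sM := bilinear_isBilinear.Build R R W W _ _ (@GRing.scale R W) sB.
pose S : {bilinear R -> W -> W} := HB.pack (@GRing.scale R W) sM.
have cS : continuous (fun p : R * W => S p.1 p.2) by move=> ?; exact: scale_continuous.
have -> : (fun y => a y *: f y) = (fun p => S p.1 p.2) \o (fun y => (a y, f y)) by [].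
have dp := differentiable_pair da df; have dS := differentiable_bilin (a x, f x) cS.
apply: DiffDef; first exact: differentiable_comp.
by rewrite diff_comp // diff_bilin // diff_pair.
Qed.

Lemma Ck_scale V W k (U : set V) (a : V -> R) (f : V -> W) : open U ->
  Ck_on k U a -> Ck_on k U f -> Ck_on k U (fun x => a x *: f x).
Proof.
move=> oU; elim: k a f => [|k IH] a f.
  by move=> h1 h2 x Ux; exact: (continuousZ (h1 x Ux) (h2 x Ux)).
move=> Ca Cf; have [a1 a2] := Ca; have [f1 f2] := Cf; split=> [x Ux|v].
  by have [] := scale_differentiable (a1 _ Ux) (f1 _ Ux).
apply: (Ck_congr oU _ (Ck_add oU (IH _ _ (Ck_weak Ca) (f2 v))
  (IH _ _ (a2 v) (Ck_weak Cf)))) => x Ux /=.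
have [d e] := scale_differentiable (a1 _ Ux) (f1 _ Ux).
rewrite [RHS](deriveE v d) e; congr (a x *: _ + _ *: f x).
  exact: (deriveE v (f1 _ Ux)).
exact: (deriveE v (a1 _ Ux)).
Qed.

Lemma linear_mx_continuous m n W (L : {linear 'M[R]_(m, n) -> W}) : continuous L.
Proof.
move=> A.
have -> : (L : _ -> _) = fun B => \sum_i \sum_j B i j *: L (delta_mx i j).
  apply/funext => B; rewrite {1}(matrix_sum_delta B) linear_sum.
  apply: eq_bigr => i _; rewrite linear_sum; apply: eq_bigr => j _.
  by rewrite linearZ.
have sC (I : Type) (s : seq I) (F : I -> 'M[R]_(m, n) -> W) :
    (forall i, {for A, continuous (F i)}) ->
    {for A, continuous (fun B => \sum_(i <- s) F i B)}.
  move=> cF; elim: s => [|i s IH].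
    have -> : (fun B => \sum_(i <- [::]) F i B) = cst (0 : W).
      by apply/funext => B; rewrite big_nil.
    exact: (@cst_continuous _ _ (0 : W)).
  have -> : (fun B => \sum_(j <- i :: s) F j B) =
      F i + (fun B => \sum_(j <- s) F j B).
    by apply/funext => B; rewrite !fctE big_cons.
  exact: (continuousD (cF i) IH).
apply: (sC) => i; apply: (sC) => j.
by apply: continuousZr_tmp; exact: coord_continuous.
Qed.

Lemma Ck_coord V m n k (U : set V) (f : V -> 'M[R]_(m, n)) i j :
  open U -> Ck_on k U f -> Ck_on k U (fun x => f x i j : R).
Proof.
move=> oU Cf; pose c (N : 'M[R]_(m, n)) : R := N i j.
have lc : linear c by move=> a u v; rewrite /c !mxE.
pose cM := GRing.isLinear.Build R 'M[R]_(m, n) R *:%R c lc.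
pose cL : {linear 'M[R]_(m, n) -> R} := HB.pack c cM.
exact: (@Ck_lin _ _ _ k U f cL oU (@coord_continuous _ _ _ i j) Cf).
Qed.

Lemma Ck_comp m n W k (U : set 'rV[R]_m) (X : set 'rV[R]_n)
    (f : 'rV[R]_m -> 'rV[R]_n) (g : 'rV[R]_n -> W) :
  open U -> (forall x, U x -> X (f x)) ->
  Ck_on k U f -> Ck_on k X g -> Ck_on k U (g \o f).
Proof.
move=> oU UX; elim: k f g UX => [|k IH] f g UX.
  move=> h1 h2 x Ux; apply: continuous_comp; first exact: h1.
  exact/h2/UX.
move=> Cf Cg; have [f1 f2] := Cf; have [g1 g2] := Cg; split=> [x Ux|v].
  by apply: differentiable_comp; [exact: f1 | exact/g1/UX].
pose D j x := 'D_v f x 0 j *: ('D_(delta_mx 0 j) g \o f) x.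
have CD j : Ck_on k U (D j).
  apply: Ck_scale => //; last exact: (IH _ _ UX (Ck_weak Cf) (g2 _)).
  exact: Ck_coord oU (f2 v).
apply: (Ck_congr oU _ (Ck_sum (index_enum 'I_n) oU CD)) => x Ux.
have df := f1 _ Ux; have dg := g1 _ (UX _ Ux).
rewrite (deriveE v (differentiable_comp df dg)) (diff_comp df dg) /=.
rewrite [in RHS](row_sum_delta ('d f x v)) linear_sum; apply: eq_bigr => j _.
by rewrite /D /= linearZ (deriveE _ dg) (deriveE v df).
Qed.
End Ck_theory.

Section geometry.
Context {R : realType} {n : nat}.

Definition smooth_fun (S : manifold R n) (W : normedModType R) (U : set S)
    (f : S -> W) : Prop :=
  forall c, matlas c ->
    smooth_on (chart_map c @` (chart_dom c `&` U)) (f \o chart_inv c).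

(* The fibres of a bundle are given as a family over the base, so that the
   total space is {p : S & E p}, the projection is projT1, and the smooth
   structure on the total space is the one the trivializations of an atlas with
   smooth transition matrices determine.  An inverse
   trivialization triv_inv t p only matters for p in the domain of t. *)
Record trivialization (S : manifold R n) (E : S -> lmodType R) (r : nat) :=
  Trivialization {
  triv_dom : set S;
  triv_map : forall p, {linear E p -> 'rV[R]_r};
  triv_inv : forall p, 'rV[R]_r -> E p;
  triv_dom_open : open triv_dom;
  triv_mapK : forall p, triv_dom p -> cancel (triv_map p) (triv_inv p);
  triv_invK : forall p, triv_dom p -> cancel (triv_inv p) (triv_map p) }.

Definition frame (S : manifold R n) (E : S -> lmodType R) (r : nat)
  (t : trivialization E r) (p : S) (i : 'I_r) : E p :=
  triv_inv t p (delta_mx 0 i).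

Definition transition (S : manifold R n) (E : S -> lmodType R) (r : nat)
    (t u : trivialization E r) (p : S) : 'M[R]_r :=
  \matrix_(i, j) triv_map u p (frame t p i) 0 j.

Record vbundle (S : manifold R n) (r : nat) := VBundle {
  fibre :> S -> lmodType R;
  vatlas : set (trivialization fibre r);
  vatlas_cover : forall p, exists2 t, vatlas t & triv_dom t p;
  vatlas_smooth : forall t u, vatlas t -> vatlas u ->
    smooth_fun (triv_dom t `&` triv_dom u) (transition t u) }.

Record bundle_morphism (S : manifold R n) (r s : nat) (E : vbundle S r)
    (F : vbundle S s) := BundleMorphism {
  morph :> forall p, {linear E p -> F p};
  morph_smooth : forall t u, vatlas t -> vatlas u ->
    smooth_fun (triv_dom t `&` triv_dom u)
      (fun p => \matrix_(i < r, j < s) triv_map u p (morph p (frame t p i)) 0 j) }.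

Definition form_family (S : manifold R n) (E : S -> lmodType R) :=
  forall p, E p -> E p -> R.

Definition posdef (V : lmodType R) (b : V -> V -> R) : Prop :=
  forall X, X != 0 -> 0 < b X X.

Definition smooth_form_on (S : manifold R n) (r : nat) (E : vbundle S r)
    (U : set S) (h : form_family E) : Prop :=
  forall t, vatlas t -> smooth_fun (triv_dom t `&` U)
    (fun p => \matrix_(i, j) h p (frame t p i) (frame t p j)).

(* A smooth fibre metric on the restriction of E to the open set U.  As the
   tangent bundle of an open submanifold U of S is the restriction of TS to U,
   for E = TS this is a smooth Riemannian metric on U. *)
Definition fibre_metric_on (S : manifold R n) (r : nat) (E : vbundle S r)
    (U : set S) (h : form_family E) : Prop :=
  [/\ open U,
      forall p, U p -> (forall X, scalar (h p X)) /\ (forall X, scalar (h p ^~ X)),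
      forall p, U p -> forall X Y, h p X Y = h p Y X,
      forall p, U p -> posdef (h p) &
      smooth_form_on U h].

End geometry.

Section tangent_bundle.
Context {R : realType} {n : nat} (S : manifold R n).
Local Notation coords := (chart R S n -> 'rV[R]_n).

Definition chart_change (c d : chart R S n) := chart_map d \o chart_inv c.

(* A tangent vector at p is given by its coordinates v c in every chart c of
   the atlas around p, related by the Jacobians of the changes of charts
   ('J has one row per source coordinate and acts on row vectors).  The
   coordinates in all other charts are fixed to 0. *)
Definition is_tangent (p : S) (v : coords) : Prop :=
  (forall c, ~ (matlas c /\ chart_dom c p) -> v c = 0) /\
  (forall c d, matlas c -> chart_dom c p -> matlas d -> chart_dom d p ->
     v d = v c *m 'J (chart_change c d) (chart_map c p)).

Definition tangent_pred (p : S) : {pred coords} := fun v => `[< is_tangent p v >].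

Fact tangent_submod p : submod_closed (tangent_pred p).
Proof.
split=> [|a u v /asboolP[u0 uJ] /asboolP[v0 vJ]]; apply/asboolP; split=> //.
- by move=> c d _ _ _ _; rewrite mul0mx.
- by move=> c nc; rewrite !fctE u0 // v0 // scaler0 addr0.
- move=> c d cA cp dA dp; rewrite !fctE (uJ c d) // (vJ c d) //.
  by rewrite mulmxDl scalemxAl.
Qed.
HB.instance Definition _ p :=
  GRing.isSubmodClosed.Build R coords (tangent_pred p) (tangent_submod p).

Record tangent_space (p : S) := Tangent {
  tangent_coords :> coords;
  tangent_coordsP : tangent_coords \in tangent_pred p }.
HB.instance Definition _ p := [isSub for @tangent_coords p].
HB.instance Definition _ p := [Choice of tangent_space p by <:].
HB.instance Definition _ p := [SubChoice_isSubLmodule of tangent_space p by <:].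

Lemma chart_change_id (c d : chart R S n) p : chart_dom c p ->
  chart_change c d (chart_map c p) = chart_map d p.
Proof.
by move=> cp; rewrite /chart_change /= chart_mapK// inE.
Qed.

Lemma chart_imgI_open (c : chart R S n) (U : set S) : open U ->
  open (chart_map c @` (chart_dom c `&` U)).
Proof.
move=> oU; rewrite openE => _ [p [cp Up] <-].
have img : (chart_map c @` chart_dom c) (chart_map c p) by exists p.
have n1 : nbhs (chart_map c p) (chart_map c @` chart_dom c).
  by apply: open_nbhs_nbhs; split=> //; exact: chart_img_open.
have n2 : nbhs (chart_map c p) (chart_inv c @^-1` U).
  apply: (chart_inv_cont img); apply: open_nbhs_nbhs; split=> //.
  by rewrite chart_mapK// inE.
apply: filterS2 n1 n2 => _ [q cq <-]; rewrite /= chart_mapK ?inE// => Uq.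
by exists q.
Qed.

Lemma chart_change_diff (c d : chart R S n) p : matlas c -> matlas d ->
  chart_dom c p -> chart_dom d p ->
  differentiable (chart_change c d) (chart_map c p).
Proof.
move=> cA dA cp dp; have [+ _] := matlas_compat cA dA 1; apply.
by exists p.
Qed.

Lemma jacobian_cocycle (c d e : chart R S n) p :
  matlas c -> matlas d -> matlas e ->
  chart_dom c p -> chart_dom d p -> chart_dom e p ->
  'J (chart_change c e) (chart_map c p) =
  'J (chart_change c d) (chart_map c p) *m 'J (chart_change d e) (chart_map d p).
Proof.
move=> cA dA eA cp dp ep.
have dcd := chart_change_diff cA dA cp dp.
have dde := chart_change_diff dA eA dp ep.
have dce := chart_change_diff cA eA cp ep.
have near_eq : \forall x \near chart_map c p,
    chart_change c e x = (chart_change d e \o chart_change c d) x.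
  have : nbhs (chart_map c p) (chart_map c @` (chart_dom c `&` chart_dom d)).
    apply: open_nbhs_nbhs; split; last by exists p.
    by apply: chart_imgI_open; exact: chart_dom_open.
  apply: filterS => _ [q [cq dq] <-].
  by rewrite /= !chart_change_id.
have dde' : differentiable (chart_change d e) (chart_change c d (chart_map c p)).
  by rewrite chart_change_id.
apply/row_matrixP => i; rewrite !rowE mulmxA.

have E := near_eq_derive (delta_mx 0 i) near_eq.
rewrite (deriveE _ dce) (deriveE _ (differentiable_comp dcd dde')) in E.
have D := congr1 (fun f => f (delta_mx 0 i)) (diff_comp dcd dde').
have P := @chart_change_id c d p cp.
rewrite P /= in D.
transitivity ('d (chart_change c e) (chart_map c p) (delta_mx 0 i)).
  exact: mul_rV_lin1.
apply: (etrans E); apply: (etrans D); apply/esym; transitivity ('d (chart_change c d) (chart_map c p)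
    (delta_mx 0 i) *m 'J (chart_change d e) (chart_map d p)).
  by congr (_ *m _); exact: mul_rV_lin1.
exact: mul_rV_lin1.
Qed.

Lemma jacobian_id (c : chart R S n) p : matlas c -> chart_dom c p ->
  'J (chart_change c c) (chart_map c p) = 1%:M.
Proof.
move=> cA cp; have dcc := chart_change_diff cA cA cp cp.
have near_eq : \forall x \near chart_map c p, chart_change c c x = x.
  have : nbhs (chart_map c p) (chart_map c @` chart_dom c).
    by apply: open_nbhs_nbhs; split; [exact: chart_img_open | exists p].
  apply: filterS => _ [q cq <-].
  by rewrite /= !chart_change_id.
apply/row_matrixP => i; rewrite !rowE mulmx1 -(deriveEjacobian _ dcc).
by rewrite (near_eq_derive _ near_eq) derive_id.
Qed.

Lemma Ck_jacobian k (U : set 'rV[R]_n) (f : 'rV[R]_n -> 'rV[R]_n) : open U ->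
  Ck_on k.+1 U f -> Ck_on k U (fun x => 'J f x).
Proof.
move=> oU [f1 f2]; pose L (i : 'I_n) : {linear 'rV[R]_n -> 'M[R]_n} := mulmx (delta_mx i 0).
have CL i : Ck_on k U (fun x => L i ('D_(delta_mx 0 i) f x)).
  exact: (Ck_lin oU (@linear_mx_continuous _ _ _ _ (L i)) (f2 _)).
apply: (Ck_congr oU _ (Ck_sum (index_enum 'I_n) oU CL)) => x Ux.
rewrite -[RHS]mul1mx -[1%:M]diag_const_mx diag_mx_sum_delta mulmx_suml.
apply: eq_bigr => i _; rewrite mxE scale1r.
rewrite -(mul_delta_mx (0 : 'I_1) i i) -mulmxA; congr (_ *m _).
exact: deriveEjacobian (f1 _ Ux).
Qed.

Definition tan_coord (c : chart R S n) (p : S) (v : tangent_space p) := v c.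

Fact tan_coord_linear c p : linear (@tan_coord c p).
Proof. by []. Qed.
HB.instance Definition _ c p :=
  GRing.isLinear.Build R (tangent_space p) 'rV[R]_n *:%R (@tan_coord c p)
    (@tan_coord_linear c p).

(* The tangent vector at p with coordinates u in the chart c. *)
Definition tan_vec (c : chart R S n) (p : S) (u : 'rV[R]_n) : tangent_space p :=
  insubd 0 (fun d => if `[< matlas d /\ chart_dom d p >]
                     then u *m 'J (chart_change c d) (chart_map c p) else 0).

Lemma tan_vecE c p u d : matlas c -> chart_dom c p -> matlas d -> chart_dom d p ->
  tan_vec c p u d = u *m 'J (chart_change c d) (chart_map c p).
Proof.
move=> cA cp dA dp; rewrite /tan_vec insubdK; first by rewrite asboolT.
apply/asboolP; split=> [e ne|e f eA ep fA fp]; first by rewrite asboolF.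
rewrite (asboolT (conj eA ep)) (asboolT (conj fA fp)).
apply: etrans (mulmxA u _ _).
by congr (u *m _); exact: jacobian_cocycle.
Qed.

Lemma tan_coordK c p : matlas c -> chart_dom c p ->
  cancel (@tan_coord c p) (tan_vec c p).
Proof.
move=> cA cp v; apply: val_inj; apply/funext => d.
have /asboolP[v0 vJ] := valP v.
case: (pselect (matlas d /\ chart_dom d p)) => [[dA dp]|nd].
  by apply: (etrans (tan_vecE _ cA cp dA dp)); apply/esym; exact: vJ.
have /asboolP[w0 _] := valP (tan_vec c p (tan_coord c v)).
by apply: (etrans (w0 _ nd)); apply/esym; exact: v0.
Qed.

Lemma tan_vecK c p : matlas c -> chart_dom c p ->
  cancel (tan_vec c p) (@tan_coord c p).
Proof. by move=> cA cp u; rewrite /tan_coord /= tan_vecE // jacobian_id // mulmx1. Qed.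

Definition tangent_triv (c : chart R S n) (cA : matlas c) :
    trivialization (fun p => tangent_space p) n :=
  @Trivialization R n S (fun p => tangent_space p) n (chart_dom c)
    (fun p => @tan_coord c p) (tan_vec c) (chart_dom_open c)
    (fun p => @tan_coordK c p cA) (fun p => @tan_vecK c p cA).

Definition tangent_atlas : set (trivialization (fun p => tangent_space p) n) :=
  [set t | exists c (cA : matlas c), t = tangent_triv cA].

Lemma tangent_cover p : exists2 t, tangent_atlas t & triv_dom t p.
Proof.
have [c cA cp] := matlas_cover p.
by exists (tangent_triv cA) => //; exists c, cA.
Qed.

Lemma tangent_smooth t u : tangent_atlas t -> tangent_atlas u ->
  smooth_fun (triv_dom t `&` triv_dom u) (transition t u).
Proof.
move=> [c [cA ->]] [d [dA ->]] e eA k /=.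
have oU : open (chart_map e @` (chart_dom e `&` (chart_dom c `&` chart_dom d))).
  by apply: chart_imgI_open; apply: openI; exact: chart_dom_open.
have oX : open (chart_map c @` (chart_dom c `&` chart_dom d)).
  by apply: chart_imgI_open; exact: chart_dom_open.
have Cec : Ck_on k (chart_map e @` (chart_dom e `&` (chart_dom c `&` chart_dom d)))
    (chart_change e c).
  apply: Ck_sub (matlas_compat eA cA k) => _ [q [eq [cq _]] <-].
  by exists q.
have CJ := Ck_jacobian oX (matlas_compat cA dA k.+1).
apply: (Ck_congr oU _ (Ck_comp oU _ Cec CJ)) => [_ [q [eq [cq dq]] <-]|
    _ [q [eq [cq dq]] <-]].
  rewrite /= chart_change_id // chart_mapK ?inE //.
  apply/matrixP => i j; rewrite [RHS]mxE.
  have E := tan_vecE (delta_mx 0 i) cA cq dA dq.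
  apply: etrans (congr1 (fun w : 'rV[R]_n => w 0 j) (esym E)).
  by rewrite -rowE [RHS]mxE.
by rewrite chart_change_id //; exists q.
Qed.

Definition tangent_bundle : vbundle S n :=
  VBundle tangent_cover tangent_smooth.

End tangent_bundle.

Section response.
Context {R : realType} {n r : nat} {S : manifold R n} {Z : vbundle S r}.

Definition response_metric (T : bundle_morphism (tangent_bundle S) Z)
    (h : form_family Z) : form_family (tangent_bundle S) :=
  fun p X Y => h p (T p X) (T p Y).

Definition riemannian_metric_on (U : set S) (g : form_family (tangent_bundle S)) :
  Prop := fibre_metric_on U g.

Definition complete_response_locus (T : bundle_morphism (tangent_bundle S) Z) :
    set S :=
  [set p | [set X | T p X = 0] = [set 0]].

End response.
Arguments response_metric {R n r S Z} T h p X Y.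

(* Main.v *)
Require Import Defs.
From HB Require Import structures.
From mathcomp Require Import all_boot all_order all_algebra.
From mathcomp Require Import all_classical all_reals all_analysis.
Import Order.TTheory GRing.Theory Num.Theory numFieldNormedType.Exports.
Local Open Scope classical_set_scope.
Local Open Scope ring_scope.

(** In local frames of the source and target bundles, a bundle morphism is a
    smooth matrix [M] and a fibre metric a smooth matrix [H]; the pulled back
    form is then [M *m H *m M^T], which is smooth.  The fibre map is injective
    exactly when [M] has full row rank, an open condition on [M]; and the
    quadratic form of the pullback vanishes exactly on the kernel, hence it is
    positive definite exactly where the fibre map is injective. *)

(** * Open conditions on matrices *)

Section matrices.
Context {R : realType}.

Lemma determinant_continuous n : continuous (fun A : 'M[R]_n => \det A).
Proof.
move=> A; apply: cvg_big => [||s _].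
- exact: add_continuous.
- exact: nbhs_filter.
- apply: (@cvgM _ _ (nbhs A)) => //; first exact: cvg_cst.
  apply: cvg_big => [|i _]; [exact: mul_continuous |].
  exact: coord_continuous.
Qed.

(** Fix a right inverse [B] of [A]. The map [N] to [\det (N *m B)] is continuous and equals 1 at
    [A], so [N *m B] stays invertible near [A], which yields a right inverse of [N]. *)
Lemma row_free_open m n : open [set A : 'M[R]_(m, n) | row_free A].
Proof.
rewrite openE => A /= /row_freeP[B AB1].
have detAB_cont : {for A, continuous (fun N : 'M[R]_(m, n) => \det (N *m B))}.
  apply: continuous_comp; last exact: determinant_continuous.
  exact: (@linear_mx_continuous R m n 'M[R]_m (mulmxr B)).
have detAB_neq0 : nbhs (\det (A *m B)) [set x : R | x != 0].
  apply: open_nbhs_nbhs; split; first exact: open_neq.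
  by rewrite /= AB1 det1 oner_neq0.
have near_neq0 : \forall N \near A, \det (N *m B) != 0.
  exact: detAB_cont detAB_neq0.
apply: filterS near_neq0 => N /= detNB.
have uNB : N *m B \in unitmx by rewrite unitmxE unitfE.
by apply/row_freeP; exists (B *m invmx (N *m B)); rewrite mulmxA mulmxV.
Qed.

End matrices.

(** * Calculus of C^k matrix-valued maps *)

Section Ck_matrix.
Context {R : realType} {V : normedModType R}.

(** [Ck_on k A f] constrains the total map [f] point by point on [A], with limits taken in the whole
    space; hence the sets [A] can be arbitrary. *)
Lemma Ck_local (W : normedModType R) k (U : set V) (f : V -> W) :
  (forall x, U x -> exists2 A : set V, A x & Ck_on k A f) -> Ck_on k U f.
Proof.
elim: k f => [|k IH] f loc; first by move=> x /loc[A Ax fA]; exact: fA.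
split=> [x /loc[A Ax [df _]]|v]; first exact: df.
by apply: IH => x /loc[A Ax [_ Df]]; exists A => //; exact: Df.
Qed.

Lemma Ck_mulmx m n p k (U : set V) (f : V -> 'M[R]_(m, n))
    (g : V -> 'M[R]_(n, p)) : open U ->
  Ck_on k U f -> Ck_on k U g -> Ck_on k U (fun x => f x *m g x).
Proof.
move=> oU Cf Cg.
(* The product is a sum of constant elementary matrices weighted by products of entries, so closure
   under scaling and sums suffices. *)
have Cfg i j l :
    Ck_on k U (fun x => f x i j *: (g x j l *: (delta_mx i l : 'M[R]_(m, p)))).
  apply: (Ck_scale oU (Ck_coord i j oU Cf)).
  exact: (Ck_scale oU (Ck_coord j l oU Cg) (Ck_cst k U _)).
apply: (Ck_congr oU _ (Ck_sum (index_enum 'I_m) oU (fun i =>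
  Ck_sum (index_enum 'I_p) oU (fun l =>
  Ck_sum (index_enum 'I_n) oU (fun j => Cfg i j l))))) => x _.
rewrite [RHS]matrix_sum_delta; apply: eq_bigr => i _; apply: eq_bigr => l _.
by rewrite mxE scaler_suml; apply: eq_bigr => j _; rewrite scalerA.
Qed.

Lemma Ck_trmx m n k (U : set V) (f : V -> 'M[R]_(m, n)) :
  open U -> Ck_on k U f -> Ck_on k U (fun x => (f x)^T).
Proof.
move=> oU Cf; apply: (@Ck_lin _ _ _ _ k U f (@trmx R m n) oU) => //.
exact: linear_mx_continuous.
Qed.

End Ck_matrix.

(** * Continuity and locality of smooth functions on a manifold *)

Section manifold_functions.
Context {R : realType} {n : nat} {S : manifold R n}.

Lemma smooth_fun_continuous (W : normedModType R) (U : set S) (f : S -> W) p :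
  open U -> smooth_fun U f -> U p -> {for p, continuous f}.
Proof.
move=> oU sf Up; have [c cA cp] := matlas_cover p.
have fc : {for chart_map c p, continuous (f \o chart_inv c)}.
  by apply: (sf c cA 0%N); exists p.
(* Passing through the chart recovers [f] on the chart domain only; this is a neighbourhood of [p],
   which is enough for the limit. *)
have fK q : chart_dom c q -> ((f \o chart_inv c) \o chart_map c) q = f q.
  by move=> cq; rewrite /= chart_mapK ?inE.
have := continuous_comp (chart_map_cont cp) fc.
rewrite /prop_for /continuous_at fK //; apply: cvg_trans.
apply: near_eq_cvg; have : nbhs p (chart_dom c).
  by apply: open_nbhs_nbhs; split=> //; exact: chart_dom_open.
by apply: filterS => q; exact: fK.
Qed.

(** This allows a smoothness proof to choose a trivialization of the target bundle separately around
    each point. *)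
Lemma smooth_fun_local (W : normedModType R) (U : set S) (f : S -> W) :
  (forall p, U p -> exists2 A : set S, A p & smooth_fun A f) -> smooth_fun U f.
Proof.
move=> loc c cA k; apply: Ck_local => _ [p [cp /loc[A Ap sf]] <-].
exists (chart_map c @` (chart_dom c `&` A)); first by exists p.
exact: sf.
Qed.

Lemma smooth_fun_congr (W : normedModType R) (U : set S) (f g : S -> W) :
  open U -> (forall p, U p -> f p = g p) -> smooth_fun U f -> smooth_fun U g.
Proof.
move=> oU fg sf c cA k; apply: Ck_congr (sf c cA k); first exact: chart_imgI_open.
by move=> _ [p [cp Up] <-] /=; rewrite chart_mapK ?inE // fg.
Qed.

End manifold_functions.

(** * Local frames and the matrix of a bundle morphism *)

Lemma frame_expansion {R : realType} {n r : nat} {S : manifold R n}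
    {E : S -> lmodType R} (t : trivialization E r) p X : triv_dom t p ->
  X = \sum_i triv_map t p X 0 i *: frame t p i.
Proof.
move=> tp; apply: (can_inj (triv_mapK tp)).
rewrite linear_sum [LHS]row_sum_delta; apply: eq_bigr => i _.
by rewrite linearZ /= triv_invK.
Qed.

Section morphism_matrix.
Context {R : realType} {n r s : nat} {S : manifold R n}.
Context {E : vbundle S r} {F : vbundle S s} (T : bundle_morphism E F).

(** Coordinates are row vectors, so the matrix acts on the right and its rows are the images of the
    frame vectors. *)
Definition morph_mx (t : trivialization E r) (u : trivialization F s) (p : S) :
    'M[R]_(r, s) :=
  \matrix_(i, j) triv_map u p (T p (frame t p i)) 0 j.

Lemma triv_map_morph t u p X : triv_dom t p ->
  triv_map u p (T p X) = triv_map t p X *m morph_mx t u p.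
Proof.
move=> tp; rewrite {1}(frame_expansion t p X tp) !linear_sum mulmx_sum_row.
apply: eq_bigr => i _; rewrite !linearZ; congr (_ *: _).
by apply/rowP => j; rewrite !mxE.
Qed.

Lemma morph_inj_row_free t u p : triv_dom t p -> triv_dom u p ->
  injective (T p) <-> row_free (morph_mx t u p).
Proof.
move=> tp up; split=> [injT|rf X Y TXY].
  (* With row vectors, full row rank means a trivial left kernel; such a [v] is the coordinate
     vector of an element killed by [T p]. *)
  apply: inj_row_free => v vM0.
  have TX0 : T p (triv_inv t p v) = T p 0.
    apply: (can_inj (triv_mapK up)); rewrite (triv_map_morph _ _ _ _ tp).
    by rewrite triv_invK // vM0 !linear0.
  by rewrite -[v](triv_invK tp) (injT _ _ TX0) linear0.
apply: (can_inj (triv_mapK tp)); apply: (row_free_inj rf).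
by rewrite /= -!triv_map_morph // TXY.
Qed.

Lemma injective_locus_open : open [set p | injective (T p)].
Proof.
rewrite openE => p /= injT.
have [t tA tp] := vatlas_cover E p; have [u uA up] := vatlas_cover F p.
have tu_open : open (triv_dom t `&` triv_dom u).
  by apply: openI; exact: triv_dom_open.
have Mcont : {for p, continuous (morph_mx t u)}.
  by apply: smooth_fun_continuous tu_open _ _; [exact: morph_smooth | split].
have rf : nbhs (morph_mx t u p) [set A | row_free A].
  apply: open_nbhs_nbhs; split; first exact: row_free_open.
  exact/(morph_inj_row_free _ _ _ tp up).
have tu_nbhs : nbhs p (triv_dom t `&` triv_dom u) by exact: open_nbhs_nbhs.
(* The same pair [t], [u] tests injectivity at every [q] of the overlap. *)
apply: filterS2 tu_nbhs (Mcont _ rf) => q [tq uq] /= rfq.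
exact/(morph_inj_row_free _ _ _ tq uq).
Qed.

Lemma morph_ker_injective p :
  [set X | T p X = 0] = [set 0] <-> injective (T p).
Proof.
split=> [ker0 X Y TXY|injT].
  apply/subr0_eq; have : [set Z | T p Z = 0] (X - Y).
    by rewrite /= linearB TXY subrr.
  by rewrite ker0.
apply/seteqP; split=> X /=; last by move=> ->; rewrite linear0.
by move=> TX0; apply: injT; rewrite linear0.
Qed.

End morphism_matrix.

(** * Bilinear forms in a local frame *)

Section bilinear_forms.
Context {R : realType} {n s : nat} {S : manifold R n} {F : vbundle S s}.

Definition form_mx (h : form_family F) (u : trivialization F s) (p : S) :
    'M[R]_s :=
  \matrix_(i, j) h p (frame u p i) (frame u p j).

Lemma form_mxE (h : form_family F) u p X Y : triv_dom u p ->
  (forall X, scalar (h p X)) -> (forall X, scalar (h p ^~ X)) ->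
  h p X Y = (triv_map u p X *m form_mx h u p *m (triv_map u p Y)^T) 0 0.
Proof.
move=> up lr ll.
(* Both partial maps of [h p] are packed as linear maps, so that [linear_sum] can expand first [Y]
   and then [X] in the frame. *)
pose hrM Z := GRing.isLinear.Build R (F p) R *%R (h p Z) (lr Z).
pose hr Z : {scalar F p} := HB.pack (h p Z) (hrM Z).
pose hlM Z := GRing.isLinear.Build R (F p) R *%R (h p ^~ Z) (ll Z).
pose hl Z : {scalar F p} := HB.pack (h p ^~ Z) (hlM Z).
rewrite {1}(frame_expansion u p Y up) -[LHS]/(hr X _) linear_sum mxE.
apply: eq_bigr => j _; rewrite linearZ mulrC [in RHS]mxE; congr (_ * _).
rewrite -[LHS]/(hl (frame u p j) X) {1}(frame_expansion u p X up) linear_sum mxE.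
by apply: eq_bigr => i _; rewrite linearZ mxE.
Qed.

End bilinear_forms.

(** * Smoothness and positivity of a pulled back form *)

Section pullback.
Context {R : realType} {n r s : nat} {S : manifold R n}.
Context {E : vbundle S r} {F : vbundle S s} (T : bundle_morphism E F).

Definition pullback_form (h : form_family F) : form_family E :=
  fun p X Y => h p (T p X) (T p Y).

Lemma pullback_form_mx (h : form_family F) t u p :
  triv_dom t p -> triv_dom u p ->
  (forall X, scalar (h p X)) -> (forall X, scalar (h p ^~ X)) ->
  form_mx (pullback_form h) t p =
  morph_mx T t u p *m form_mx h u p *m (morph_mx T t u p)^T.
Proof.
move=> tp up lr ll; apply/matrixP => i j.
have rowM k : triv_map u p (T p (frame t p k)) = row k (morph_mx T t u p).
  by apply/rowP => l; rewrite !mxE.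
rewrite mxE /pullback_form (form_mxE _ _ _ _ _ up) // !rowM.
by rewrite -row_mul !mxE; apply: eq_bigr => l _; rewrite !mxE.
Qed.

Lemma pullback_form_smooth (h : form_family F) (U : set S) : open U ->
  fibre_metric_on setT h -> smooth_form_on U (pullback_form h).
Proof.
move=> oU [_ lin _ _ sh] t tA; apply: smooth_fun_local => p [tp Up].
have [u uA up] := vatlas_cover F p.
have tu_open : open (triv_dom t `&` triv_dom u).
  by apply: openI; exact: triv_dom_open.
(* The matrix formula involves [u], hence holds only on this overlap; locality of smoothness makes
   that sufficient. *)
exists (triv_dom t `&` triv_dom u) => //.
apply: (@smooth_fun_congr _ _ _ _ _ (fun q =>
  morph_mx T t u q *m form_mx h u q *m (morph_mx T t u q)^T)) => //.
  move=> q [tq uq]; have [lr ll] := lin q I.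
  by rewrite -(pullback_form_mx _ _ _ _ tq uq).
move=> c cA k.
have oA := chart_imgI_open (c := c) tu_open.
have CM := morph_smooth T tA uA cA k.
have CH : Ck_on k (chart_map c @` (chart_dom c `&` (triv_dom t `&` triv_dom u)))
    (form_mx h u \o chart_inv c).
  apply: Ck_sub (sh u uA c cA k).
  by move=> _ [q [cq [_ uq]] <-]; exists q.
have CMH := Ck_mulmx _ _ _ _ _ _ _ oA CM CH.
exact: (Ck_mulmx _ _ _ _ _ _ _ oA CMH (Ck_trmx _ _ _ _ _ oA CM)).
Qed.

(** If [T p] is injective, it sends nonzero vectors to nonzero vectors, where [h p] is positive.
    Conversely, if [T p] identified distinct [X] and [Y], the pullback would vanish on the nonzero
    vector [X - Y]. *)
Lemma pullback_posdef (h : form_family F) p :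
  (forall X, scalar (h p X)) -> posdef (h p) ->
  injective (T p) <-> posdef (pullback_form h p).
Proof.
move=> lr hpos; split=> [injT X X0|gpos X Y TXY].
  apply: hpos; apply: contra_neq X0 => TX0.
  by apply: injT; rewrite linear0.
apply/subr0_eq/eqP; apply: contraT => /gpos.
rewrite /pullback_form linearB TXY subrr.
(* Linearity at the scalar -1 and zero vectors gives [h p 0 0 = 0]. *)
have := lr 0 (- 1) 0 0; rewrite scaler0 addr0 mulN1r addNr => ->.
by rewrite ltxx.
Qed.

End pullback.

Theorem theorem3p3 (R : realType) (n r : nat) (S : manifold R n)
    (Z : vbundle S r) (hZ : form_family Z) (hZ_metric : fibre_metric_on setT hZ)
    (Rsp : bundle_morphism (tangent_bundle S) Z) :
  riemannian_metric_on (complete_response_locus Rsp) (response_metric Rsp hZ) /\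
  (forall p : S,
     (complete_response_locus Rsp p <-> injective (Rsp p)) /\
     (injective (Rsp p) <-> posdef (response_metric Rsp hZ p))).
Proof.
have [_ lin sym pos _] := hZ_metric.
have injE p : complete_response_locus Rsp p <-> injective (Rsp p).
  exact: morph_ker_injective.
have posE p : injective (Rsp p) <-> posdef (response_metric Rsp hZ p).
  (* [response_metric] unfolds to [pullback_form] along [Rsp]. *)
  by apply: pullback_posdef; [have [] := lin p I | exact: pos].
have oU : open (complete_response_locus Rsp).
  rewrite (_ : complete_response_locus Rsp = [set p | injective (Rsp p)]).
    exact: injective_locus_open.
  by apply/seteqP; split=> p /injE.
split; last by move=> p; split.
(* Openness is [oU]; bilinearity, symmetry, positivity and smoothness remain. *)
split=> //.
- move=> p _; have [lr ll] := lin p I.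
  by split=> X a Y W; rewrite /response_metric linearP; [exact: lr | exact: ll].
- by move=> p _ X Y; exact: sym.
- by move=> p /injE/posE.
- exact: pullback_form_smooth.
Qed.
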